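(* Let $g\ge2$ and $\alpha>\frac12$. There exists $B_\alpha\in B_2[g]$ such that $$\sum_{b\in B_\alpha}\frac{1}{b^\alpha}=\sup\Big\{\sum_{b\in B}b^{-\alpha} : B\in B_2[g]\Big\}.$$
   Context: For integers $h\ge2$, $g\ge1$, $B_h[g]$ denotes the family of sets $B$ of positive integers such that for every integer $k$ there are at most $g$ multisets $\{x_1,\dots,x_h\}$ of elements of $B$ (repetitions allowed) with $x_1+\dots+x_h=k$. *)

(* Defs.v *)
From mathcomp Require Import all_boot all_order all_algebra.
From mathcomp Require Import finmap multiset.
From mathcomp Require Import all_classical all_reals all_analysis.

Set Implicit Arguments.
Unset Strict Implicit.
Unset Printing Implicit Defensive.

Local Open Scope classical_set_scope.
Local Open Scope card_scope.
Local Open Scope mset_scope.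

Definition representations (B : set nat) (h : nat) (k : int) : set {mset nat} :=
  [set m : {mset nat} |
    [/\ size m = h,
        forall x : nat, x \in m -> B x
      & Posz (\sum_(x <- m) x)%N = k]].

(* Intended for h >= 2 and g >= 1; a set of positive integers is a [set nat]
   all of whose elements are nonzero. *)
Definition B_ (h g : nat) : set (set nat) :=
  [set B : set nat |
    (forall b : nat, B b -> (0 < b)%N) /\
    (forall k : int, representations B h k #<= `I_g)].

(* Main.v *)
Require Import Defs.
From mathcomp Require Import all_boot all_order all_algebra.
From mathcomp Require Import finmap multiset.
From mathcomp Require Import zify ring lra.
From mathcomp Require Import all_classical all_reals all_analysis.
Import Order.TTheory GRing.Theory Num.Theory.
Import numFieldNormedType.Exports.

(* Counting pairs by their sum gives |B `&` [0, M)|^2 <= 4 g M for B in B_2[g],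
   so the part of the sum over [2^K, 2^(K+1)) is O(r^K) with
   r = 2^(1/2 - alpha) < 1: tails are small uniformly in B.  Membership in
   B_2[g] only constrains finite pieces of B, so the limit of a maximizing
   sequence along a nonprincipal ultrafilter is again in B_2[g]; it agrees with
   suitable terms of the sequence on each [0, 2^J), and the uniform tail bound
   then shows that it attains the supremum. *)

Local Open Scope classical_set_scope.
Local Open Scope ring_scope.

(** * Representations and the counting bound for $B_2[g]$ *)

Lemma card_le_finset (T : finType) (U : Type) (A : set U) (F : {set T})
    (f : T -> U) (n : nat) :
  (A #<= `I_n)%card -> {in F &, injective f} ->
  (forall x, x \in F -> A (f x)) -> (#|F| <= n)%N.
Proof.
move=> /pcard_leP/injfunPex[h hI hinj] finj fA.
rewrite cardE -(size_map (h \o f)) -[leqRHS](size_iota 0).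
apply: uniq_leq_size.
  rewrite map_inj_in_uniq ?enum_uniq// => x y.
  rewrite !mem_enum => xF yF /= hxy.
  by apply: finj => //; apply: hinj => //; rewrite inE; apply: fA.
move=> z /mapP[x]; rewrite mem_enum => xF ->.
by rewrite mem_iota add0n; apply: hI; apply: fA.
Qed.

(** No summand exceeds the total. This locality is what lets [B_ h g] pass to ultralimits. *)
Lemma representations_agree (B C : set nat) (h k : nat) :
  (forall x, (x <= k)%N -> B x <-> C x) ->
  representations B h k = representations C h k.
Proof.
move=> BC; apply/seteqP; split => m [hm mB [mk]]; split; rewrite ?mk// => x xm.
all: have xk : (x <= k)%N by rewrite -mk (big_rem x)//= leq_addr.
all: by apply/BC => //; apply: mB.
Qed.

Lemma representations_Negz (B : set nat) (h k : nat) :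
  representations B h (Negz k) = set0.
Proof. by apply/seteqP; split => m // -[]. Qed.

(** Pairs with p.1 <= p.2 inject into the multisets representing k, so there are at most g of them;
    swapping coordinates covers the rest, whence the factor 2. *)
Lemma card_sum_pairs_le (B : set nat) (g M k : nat) : B_ 2 g B ->
  (#|[set p : 'I_M * 'I_M | [&& (p.1 : nat) \in B, (p.2 : nat) \in B
      & p.1 + p.2 == k]]%SET| <= 2 * g)%N.
Proof.
move=> [_ Bg]; set P := [set p | _]%SET.
pose P1 := [set p in P | (p.1 <= p.2)%N]%SET.
have P1g : (#|P1| <= g)%N.
  apply: (@card_le_finset _ _ _ _
    (fun p : 'I_M * 'I_M => seq_mset [:: p.1 : nat; p.2 : nat]) _ (Bg k)).
    move=> [x y] [x' y']; rewrite !inE /= => /andP[/and3P[_ _ /eqP xy] lexy].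
    move=> /andP[/and3P[_ _ /eqP xy'] lexy'] /eq_seq_msetP/perm_mem/(_ x).
    rewrite !inE eqxx /= => /esym/orP xE.
    suff : (x = x' :> nat) /\ (y = y' :> nat) by case=> /val_inj -> /val_inj ->.
    (* If x = y', equal sums give y = x', and the two orderings force all four to coincide. *)
    by case: xE => /eqP; lia.
  move=> [x y]; rewrite !inE /= => /andP[/and3P[xB yB /eqP xy] _].
  have pm := perm_eq_seq_mset [:: x : nat; y : nat].
  split; first by rewrite (perm_size pm).
    by move=> z; rewrite (perm_mem pm) !inE => /orP[]/eqP->; exact/set_mem.
  by rewrite (perm_big _ pm)/= !big_cons big_nil addn0 xy.
pose swap (p : 'I_M * 'I_M) := (p.2, p.1).
have swapK : cancel swap swap by case.
have PU : P \subset P1 :|: swap @: P1.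
  apply/fintype.subsetP => -[x y] xyP; rewrite !inE.
  have [xy|/ltnW yx] := leqP x y; first by move: xyP; rewrite !inE /= => ->.
  apply/orP; right; apply/imsetP; exists (y, x) => //.
  by move: xyP; rewrite !inE /= yx addnC andbT => /and3P[-> -> ->].
apply: (leq_trans (subset_leq_card PU)).
rewrite (leq_trans (leq_card_setU _ _))//.
by rewrite card_imset; [rewrite mul2n -addnn leq_add|exact: can_inj swapK].
Qed.

(** Split A x A by the sum of the coordinates: there are 2M possible values, each taken by at most
    2g pairs. *)
Lemma sqr_card_le (B : set nat) (g M : nat) : B_ 2 g B ->
  (#|[set x : 'I_M | (x : nat) \in B]%SET| ^ 2 <= 4 * g * M)%N.
Proof.
move=> Bg; set A := [set x | _]%SET.
rewrite -mulnn -cardsX.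
have sumltn (p : 'I_M * 'I_M) : (p.1 + p.2 < M + M)%N.
  by rewrite -addnS leq_add// ltnW.
rewrite -sum1_card (partition_big (fun p => Ordinal (sumltn p)) xpredT)//=.
rewrite [leqRHS](_ : _ = \sum_(i < M + M) (2 * g))%N; last first.
  by rewrite sum_nat_const card_ord; lia.
apply: leq_sum => k _; rewrite sum1dep_card.
apply: leq_trans (@card_sum_pairs_le B g M k Bg).
apply/subset_leq_card/fintype.subsetP => -[x y]; rewrite !inE /=.
by move=> /andP[/andP[-> ->]].
Qed.

(** * Dyadic blocks and uniform tail bounds *)

Definition partial_sum {R : realType} (alpha : R) (B : set nat) (n : nat) : R :=
  \sum_(0 <= i < n | i \in B) i%:R `^ (- alpha).

(** This is 2^(1/2 - alpha), kept as a product: in its K-th power one factor comes from counting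
    elements, the other from the size of the terms. *)
Definition dyadic_ratio {R : realType} (alpha : R) : R :=
  Num.sqrt 2 * 2 `^ (- alpha).

Lemma eq_partial_sum {R : realType} (alpha : R) (B C : set nat) (n : nat) :
  (forall x, (x < n)%N -> B x <-> C x) ->
  partial_sum alpha B n = partial_sum alpha C n.
Proof.
move=> BC; rewrite /partial_sum big_nat_cond [RHS]big_nat_cond.
apply: eq_bigl => i; case: ltnP => //= iln; apply/idP/idP.
  by move=> /set_mem/(BC _ iln)/mem_set.
by move=> /set_mem/(BC _ iln)/mem_set.
Qed.

(** Each term with index at least 2^K is at most 2^(-alpha K), and the number n of elements of B
    below 2^(K+1) satisfies n^2 <= 4g 2^(K+1) = 8g 2^K. *)
Lemma partial_sum_dyadic_step {R : realType} (alpha : R) (g : nat) (B : set nat)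
    (K : nat) : 0 <= alpha -> B_ 2 g B ->
  partial_sum alpha B (2 ^ K.+1) <= partial_sum alpha B (2 ^ K) +
    Num.sqrt (8 * g)%:R * dyadic_ratio alpha ^+ K.
Proof.
move=> alpha0 Bg; set p : R := 2 `^ (- alpha).
pose a (i : nat) : R := i%:R `^ (- alpha).
rewrite /partial_sum /dyadic_ratio -/p (@big_cat_nat _ _ _ (2 ^ K))//=;
  last by rewrite leq_exp2l.
rewrite lerD2l.
set n := #|[set x : 'I_(2 ^ K.+1) | (x : nat) \in B]%SET|.
have aK i : (2 ^ K <= i)%N -> a i <= p ^+ K.
  move=> iK; rewrite -powR_mulrn ?powR_ge0// /p -powRrM mulrC powRrM.
  rewrite powR_mulrn// -natrX /a !powRN lef_pV2 ?posrE ?powR_gt0 ?ltr0n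
    ?expn_gt0//.
    by rewrite ge0_ler_powR ?nnegrE// ler_nat.
  by rewrite (leq_trans _ iK)// expn_gt0.
have nE : n%:R = \sum_(0 <= i < 2 ^ K.+1 | i \in B) (1 : R).
  by rewrite big_mkord sumr_const /n cardsE.
apply: (@le_trans _ _ (n%:R * p ^+ K)).
  (* Here n also counts the elements below 2^K; their nonnegative contribution is dropped. *)
  rewrite nE mulr_suml [leRHS](@big_cat_nat _ _ _ (2 ^ K))//=;
  last by rewrite leq_exp2l.
  rewrite -[leLHS]add0r lerD ?sumr_ge0// => [i _|].
    by rewrite mul1r exprn_ge0 ?powR_ge0.
  rewrite big_nat_cond [leRHS]big_nat_cond ler_sum// => i /andP[/andP[Ki _] _].
  by rewrite mul1r aK.
rewrite exprMn mulrA ler_wpM2r ?exprn_ge0 ?powR_ge0//.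
rewrite -ler_sqr ?nnegrE ?mulr_ge0 ?exprn_ge0 ?sqrtr_ge0//.
rewrite exprMn exprAC !sqr_sqrtr// -!natrX -natrM ler_nat.
by apply: (leq_trans (sqr_card_le _ g _ Bg)); rewrite expnS; lia.
Qed.

Lemma dyadic_ratio_lt1 {R : realType} (alpha : R) : 1 / 2 < alpha ->
  dyadic_ratio alpha < 1.
Proof.
move=> h; rewrite /dyadic_ratio -powR12_sqrt// -powRD;
  last by rewrite pnatr_eq0 implybT.
rewrite /powR pnatr_eq0 /= expR_lt1 pmulr_llt0 ?ln_gt0 ?ltr1n//.
lra.
Qed.

Lemma partial_sum_tail {R : realType} (alpha : R) (g : nat) (B : set nat)
    (J K : nat) : 1 / 2 < alpha -> B_ 2 g B -> (J <= K)%N ->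
  partial_sum alpha B (2 ^ K) <= partial_sum alpha B (2 ^ J) +
    Num.sqrt (8 * g)%:R / (1 - dyadic_ratio alpha) * dyadic_ratio alpha ^+ J.
Proof.
move=> ha Bg JK; set q := dyadic_ratio alpha.
have q1 : q < 1 by exact: dyadic_ratio_lt1.
have q0 : 0 <= q by rewrite mulr_ge0 ?sqrtr_ge0 ?powR_ge0.
set c := Num.sqrt _; have c0 : 0 <= c by exact: sqrtr_ge0.
(* Keeping - q^K makes the induction close, since c / (1 - q) * (q^K - q^(K+1)) = c q^K. *)
suff : partial_sum alpha B (2 ^ K) <=
    partial_sum alpha B (2 ^ J) + c / (1 - q) * (q ^+ J - q ^+ K).
  move=> /le_trans; apply; rewrite lerD2l ler_wpM2l//.
    by rewrite divr_ge0// subr_ge0 ltW.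
  by rewrite gerBl exprn_ge0.
elim: K JK => [|K IH].
  by rewrite leqn0 => /eqP->; rewrite subrr mulr0 addr0.
rewrite leq_eqVlt => /orP[/eqP->|JK]; first by rewrite subrr mulr0 addr0.
apply: (le_trans (partial_sum_dyadic_step alpha g B K _ Bg)); first by lra.
move: (IH JK); rewrite -/q -/c => {}IH.
have -> : c / (1 - q) * (q ^+ J - q ^+ K.+1) =
    c / (1 - q) * (q ^+ J - q ^+ K) + c * q ^+ K.
  have q1' : 1 - q != 0 by rewrite subr_eq0 gt_eqF.
  by rewrite exprS; field.
by rewrite addrA lerD2r.
Qed.

Lemma esum_bounds {R : realType} (alpha : R) (g : nat) (B : set nat) (J : nat) :
  1 / 2 < alpha -> B_ 2 g B ->
  ((partial_sum alpha B (2 ^ J))%:E <= \esum_(b in B) (b%:R `^ (- alpha))%:E <=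
  (partial_sum alpha B (2 ^ J) +
    Num.sqrt (8 * g)%:R / (1 - dyadic_ratio alpha) * dyadic_ratio alpha ^+ J)%:E)%E.
Proof.
move=> ha Bg; pose a (i : nat) : R := i%:R `^ (- alpha).
have a0 n : true -> n \in B -> (0 <= (a n)%:E)%E by rewrite lee_fin powR_ge0.
rewrite [X in (_ <= X <= _)%E](_ : _ =
  \sum_(0 <= i <oo | i \in B) (a i)%:E)%E; last first.
  rewrite nneseries_esum//; last by move=> n; apply: a0.
  by congr esum; apply/seteqP; split=> x /=; rewrite inE.
apply/andP; split.
  by rewrite /partial_sum -sumEFin; apply: nneseries_lim_ge => n _; exact: a0.
apply: lime_le; first by apply: is_cvg_nneseries => n _; exact: a0.
near=> n.
have partial_sum_le m :
    (n <= m)%N -> partial_sum alpha B n <= partial_sum alpha B m.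
  move=> nm.
  by rewrite /partial_sum (@big_cat_nat _ _ _ n _ m)//= lerDl sumr_ge0.
(* As n < 2^n, the n-th partial sum is dominated by one at a power of 2, where the tail bound
   applies once n >= J. *)
rewrite sumEFin lee_fin; apply: (le_trans (partial_sum_le (2 ^ n)%N _)).
  by rewrite ltnW// ltn_expl.
apply: partial_sum_tail => //.
near: n; exact: nbhs_infty_ge.
Unshelve. all: by end_near. Qed.

(** * Ultralimits of sequences of sets *)

Lemma ultralimit_agree (G : set_system nat) (B : nat -> set nat) (N : nat) :
  UltraFilter G ->
  \forall n \near G, forall x, (x < N)%N -> B n x <-> G [set m | B m x].
Proof.
move=> GU; elim: N => [|N IH]; first exact: filterE.
have {}GN : \forall n \near G, B n N <-> G [set m | B m N].
  (* The ultrafilter decides whether N lies in [B m] for G-almost all m; either way those m agree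
     with the limit at N. *)
  have [GB|GnB] := in_ultra_setVsetC [set m | B m N] GU.
    by apply: filterS (GB) => n Bn; split.
  apply: filterS (GnB) => n nBn; split => // GB; exfalso.
  by have [m []] := filter_ex (filterI GB GnB).
apply: filterS2 IH GN => n agree agreeN x.
by rewrite ltnS leq_eqVlt => /orP[/eqP->|/agree].
Qed.

(** For each k the limit agrees on [0, k] with some [B n], so both have the same representations of
    k. *)
Lemma ultralimit_B_ (G : set_system nat) (B : nat -> set nat) (h g : nat) :
  UltraFilter G -> (forall n, B_ h g (B n)) ->
  B_ h g [set x | G [set m | B m x]].
Proof.
move=> GU BB; split=> [x /= /filter_ex[m]|[k|k]]; first exact: (BB m).1.
  have [n agree] := filter_ex (ultralimit_agree G B k.+1 GU).
  rewrite -(@representations_agree (B n)) => [|x xk]; last exact: agree.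
  exact: (BB n).2.
by rewrite representations_Negz card_ge0.
Qed.

(** * Attaining the supremum *)

Lemma B_2_set0 (g : nat) : B_ 2 g set0.
Proof.
split=> // k; suff -> : representations set0 2 k = set0 by exact: card_ge0.
apply/seteqP; split=> // m [m2 m0 _].
by have := m0 (nth 0%N m 0) (mem_nth _ _); rewrite m2; apply.
Qed.

Theorem theorem6p1 (R : realType) (g : nat) (hg : (2 <= g)%N)
  (alpha : R) (halpha : 1 / 2 < alpha) :
  exists2 Balpha : set nat, B_ 2 g Balpha &
    (\esum_(b in Balpha) (1 / (b%:R `^ alpha))%:E =
     ereal_sup [set \esum_(b in B) (b%:R `^ (- alpha))%:E | B in B_ 2 g])%E.
Proof.
set E := [set _ | B in _]; set S := ereal_sup E.
have bounds B J := esum_bounds alpha g B J halpha.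
set C := Num.sqrt (8 * g)%:R / (1 - dyadic_ratio alpha) in bounds.
have Sfin : S \is a fin_num.
  rewrite ge0_fin_numE; last first.
    by apply: ereal_sup_ubound; exists set0;
      [exact: B_2_set0|rewrite esum_set0].
  (* Take J = 0: only the index 0 lies below 2^0, so one constant bounds every sum. *)
  apply: (@le_lt_trans _ _ (0 `^ (- alpha) + C)%:E); last exact: ltry.
  apply: ge_ereal_sup => _ [B BB <-].
  have /andP[_ /le_trans] := bounds B 0%N BB; apply.
  rewrite lee_fin expr0 mulr1 lerD2r /partial_sum expn0 big_mkcond big_nat1 /=.
  by case: ifP => // _; exact: powR_ge0.
have /choice[B BP] (n : nat) : exists B, B_ 2 g B /\
    (S - n.+1%:R^-1%:E < \esum_(b in B) (b%:R `^ (- alpha))%:E)%E.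
  have /ub_ereal_sup_adherent/(_ Sfin)[_ [B BB <-] ?] : 0 < n.+1%:R^-1 :> R.
    by rewrite invr_gt0.
  by exists B.
(* G refines the filter of eventual properties, so whatever holds for all large n holds G-almost
   everywhere. *)
have [G [GU Goo]] := ultraFilterLemma eventually_filter.
pose Bl := [set x | G [set m | B m x]].
have BlB : B_ 2 g Bl by apply: ultralimit_B_ => // n; have [] := BP n.
exists Bl => //.
under eq_esum do rewrite div1r -powRN.
apply/eqP; rewrite eq_le; apply/andP; split.
  by apply: ereal_sup_ubound; exists Bl.
apply/lee_addgt0Pr => e e0.
have e2 : 0 < e / 2 by rewrite divr_gt0.
have [J CJ] : exists J, C * dyadic_ratio alpha ^+ J < e / 2.
  have q1 : `|dyadic_ratio alpha| < 1.
    by rewrite ger0_norm ?dyadic_ratio_lt1// mulr_ge0 ?sqrtr_ge0 ?powR_ge0.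
  exact: filter_ex (cvgr_lt _ (cvg_geometric C q1) _ e2).
have large : \forall n \near G, n.+1%:R^-1 < e / 2.
  exact: Goo (near_infty_natSinv_lt (PosNum e2)).
have [n [ne agree]] :=
  filter_ex (filterI large (ultralimit_agree G B (2 ^ J) GU)).
have [BnB Sn] := BP n.
have /andP[_ up] := bounds (B n) J BnB.
have /andP[low _] := bounds Bl J BlB.
(* [B n] and [Bl] share their partial sum up to 2^J, so S exceeds the sum over [Bl] by at most the
   tail plus 1/(n+1), each below e/2. *)
rewrite (eq_partial_sum _ _ Bl _ agree) in up.
move: Sn; rewrite lteBlDr// => /ltW /le_trans; apply.
apply: (le_trans (leeD2r _ up)); rewrite -EFinD.
apply: (le_trans _ (leeD2r _ low)); rewrite -EFinD lee_fin.
by rewrite -addrA lerD2l [leRHS]splitr lerD// ltW.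
Qed.
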